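(* The state space functor $S\colon\mathsf{DDS}\to\mathsf{DiGraph}$ identifies $\mathsf{DDS}$ with the full subcategory of $\mathsf{DiGraph}$ spanned by the digraphs in which every vertex has a unique edge pointing out; that is, $S$ is full and faithful and its essential image consists exactly of the digraphs such that every vertex is the source of exactly one edge.
   Context: $\mathsf{DDS}$ is the category of discrete dynamical systems: objects are pairs $(X,f)$ with $X$ a set and $f\colon X\to X$ a function, morphisms $(X,f)\to(Y,g)$ are functions $\alpha$ with $\alpha f=g\alpha$. A digraph is a set of vertices together with a set of directed edges, with at most one edge from any given vertex to any given vertex, loops allowed; a graph map is a function on vertices carrying edges to edges; these form $\mathsf{DiGraph}$. The state space functor $S$ sends $(X,f)$ to the digraph with vertex set $X$ and an edge $x\to f(x)$ for every $x\in X$, and sends a morphism $\alpha$ to the graph map given by $\alpha$ on vertices. *)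

(* Defs.v *)
From Stdlib Require Import ProofIrrelevance.

Record Category : Type := {
  Obj : Type;
  Hom : Obj -> Obj -> Type;
  idc : forall A, Hom A A;
  comp : forall A B C, Hom B C -> Hom A B -> Hom A C;
  comp_id_l : forall A B (f : Hom A B), comp A B B (idc B) f = f;
  comp_id_r : forall A B (f : Hom A B), comp A A B f (idc A) = f;
  comp_assoc : forall A B C D (h : Hom C D) (g : Hom B C) (f : Hom A B),
    comp A C D h (comp A B C g f) = comp A B D (comp B C D h g) f
}.

Arguments Hom {_} _ _.
Arguments idc {_} _.
Arguments comp {_ _ _ _} _ _.

Record Functor (C D : Category) : Type := {
  fobj : Obj C -> Obj D;
  fmap : forall A B : Obj C, Hom A B -> Hom (fobj A) (fobj B);
  fmap_id : forall A : Obj C, fmap A A (idc A) = idc (fobj A);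
  fmap_comp : forall (A B E : Obj C) (g : Hom B E) (f : Hom A B),
    fmap A E (comp g f) = comp (fmap B E g) (fmap A B f)
}.

Arguments fobj {_ _} _ _.
Arguments fmap {_ _} _ {_ _} _.

Definition full {C D : Category} (F : Functor C D) : Prop :=
  forall (A B : Obj C) (h : Hom (fobj F A) (fobj F B)),
    exists f : Hom A B, fmap F f = h.

Definition faithful {C D : Category} (F : Functor C D) : Prop :=
  forall (A B : Obj C) (f g : Hom A B), fmap F f = fmap F g -> f = g.

Definition isomorphic {C : Category} (A B : Obj C) : Prop :=
  exists (f : Hom A B) (g : Hom B A), comp g f = idc A /\ comp f g = idc B.

Definition in_essential_image {C D : Category} (F : Functor C D)
    (Y : Obj D) : Prop :=
  exists A : Obj C, isomorphic (fobj F A) Y.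

Record dds : Type := { state : Type; step : state -> state }.

Record dds_hom (A B : dds) : Type := {
  dds_fun : state A -> state B;
  dds_commutes : forall x, dds_fun (step A x) = step B (dds_fun x)
}.

Arguments dds_fun {_ _} _ _.
Arguments dds_commutes {_ _} _ _.

Lemma dds_hom_eq (A B : dds) (f g : dds_hom A B) :
  dds_fun f = dds_fun g -> f = g.
Proof.
  destruct f as [f Hf], g as [g Hg]; simpl; intros E; subst g.
  f_equal; apply proof_irrelevance.
Qed.

Definition dds_id (A : dds) : dds_hom A A :=
  {| dds_fun := fun x => x; dds_commutes := fun x => eq_refl |}.

Definition dds_comp (A B C : dds) (g : dds_hom B C) (f : dds_hom A B) :
    dds_hom A C :=
  {| dds_fun := fun x => dds_fun g (dds_fun f x);
     dds_commutes := fun x =>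
       eq_trans (f_equal (dds_fun g) (dds_commutes f x))
                (dds_commutes g (dds_fun f x)) |}.

Definition DDS : Category.
Proof.
  refine {| Obj := dds; Hom := dds_hom; idc := dds_id; comp := dds_comp |};
    intros; apply dds_hom_eq; reflexivity.
Defined.

(* Edges form a relation on vertices, so that there is at most one edge from
   any given vertex to any given vertex; an edge is determined by its source
   and its target. *)
Record digraph : Type := { vertex : Type; edge : vertex -> vertex -> Prop }.

Record graph_map (G H : digraph) : Type := {
  vertex_fun : vertex G -> vertex H;
  map_edge : forall v w, edge G v w -> edge H (vertex_fun v) (vertex_fun w)
}.

Arguments vertex_fun {_ _} _ _.
Arguments map_edge {_ _} _ _ _ _.

Lemma graph_map_eq (G H : digraph) (f g : graph_map G H) :
  vertex_fun f = vertex_fun g -> f = g.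
Proof.
  destruct f as [f Hf], g as [g Hg]; simpl; intros E; subst g.
  f_equal; apply proof_irrelevance.
Qed.

Definition graph_id (G : digraph) : graph_map G G :=
  {| vertex_fun := fun v => v; map_edge := fun v w e => e |}.

Definition graph_comp (G H K : digraph) (g : graph_map H K)
    (f : graph_map G H) : graph_map G K :=
  {| vertex_fun := fun v => vertex_fun g (vertex_fun f v);
     map_edge := fun v w e => map_edge g _ _ (map_edge f v w e) |}.

Definition DiGraph : Category.
Proof.
  refine {| Obj := digraph; Hom := graph_map; idc := graph_id;
            comp := graph_comp |};
    intros; apply graph_map_eq; reflexivity.
Defined.

Definition state_space (A : dds) : digraph :=
  {| vertex := state A; edge := fun x y => step A x = y |}.

Definition state_space_map (A B : dds) (f : dds_hom A B) :
    graph_map (state_space A) (state_space B) :=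
  @Build_graph_map (state_space A) (state_space B) (dds_fun f)
    (fun x y (e : step A x = y) =>
       eq_trans (eq_sym (dds_commutes f x)) (f_equal (dds_fun f) e)).

Definition StateSpace : Functor DDS DiGraph.
Proof.
  refine (@Build_Functor DDS DiGraph state_space state_space_map _ _);
    intros; apply graph_map_eq; reflexivity.
Defined.

(* Since an edge out of [v] is determined by its target, this says that each
   vertex is the source of exactly one edge. *)
Definition unique_out_edge (G : digraph) : Prop :=
  forall v : vertex G, exists! w : vertex G, edge G v w.

(* Main.v *)
Require Import Defs.
From Stdlib Require Import IndefiniteDescription.

(** In a state space the only edge out of [x] goes to [step A x], so a function on states preserves
    edges exactly when it commutes with the dynamics; hence [StateSpace] is full and faithful.
    Unique out-edges survive isomorphism, so they hold throughout the essential image. Conversely,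
    sending each vertex to the target of its only out-edge defines a system whose state space is the
    given digraph. *)

Lemma state_space_full : full StateSpace.
Proof.
  intros A B h.
  (* [h] carries the edge [x -> step A x] to an edge of the state space of [B],
     which is exactly the commutation equation. *)
  exists (Build_dds_hom A B (vertex_fun h)
            (fun x => eq_sym (map_edge h x (step A x) eq_refl))).
  now apply graph_map_eq.
Qed.

Lemma state_space_faithful : faithful StateSpace.
Proof.
  intros A B f g E.
  apply dds_hom_eq.
  exact (f_equal (@vertex_fun (state_space A) (state_space B)) E).
Qed.

Lemma unique_out_edge_state_space (A : dds) : unique_out_edge (state_space A).
Proof.
  intros x; exists (step A x); split; [reflexivity | easy].
Qed.

(** The edge out of [v] is the image under [f] of the one out of [g v]; any other target [y] is
    pulled back by [g], where uniqueness in [G] applies. *)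
Lemma unique_out_edge_isomorphic (G H : Obj DiGraph) :
  isomorphic G H -> unique_out_edge G -> unique_out_edge H.
Proof.
  intros (f & g & _ & Hfg) HG v.
  assert (fgK : forall y, vertex_fun f (vertex_fun g y) = y).
  { intros y; exact (f_equal (fun k : graph_map H H => vertex_fun k y) Hfg). }
  destruct (HG (vertex_fun g v)) as (w & Hw & w_unique).
  exists (vertex_fun f w); split.
  - rewrite <- (fgK v); exact (map_edge f _ _ Hw).
  - intros y Hy.
    rewrite (w_unique _ (map_edge g _ _ Hy)); apply fgK.
Qed.

Lemma unique_out_edge_in_essential_image (G : digraph) :
  unique_out_edge G -> in_essential_image StateSpace G.
Proof.
  intros HG.
  (* The chosen relation includes uniqueness: [Hs] gives both that [s v] is a target, for [to_G],
     and that every target equals it, for [of_G]. *)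
  destruct (functional_choice _ HG) as [s Hs].
  set (A := Build_dds (vertex G) s).
  assert (to_G : forall v w, edge (state_space A) v w -> edge G v w).
  { intros v w <-; apply Hs. }
  assert (of_G : forall v w, edge G v w -> edge (state_space A) v w).
  { intros v w; apply Hs. }
  exists A,
    (Build_graph_map (state_space A) G (fun v => v) to_G),
    (Build_graph_map G (state_space A) (fun v => v) of_G).
  split; now apply graph_map_eq.
Qed.

Theorem corollary1p20 :
  full StateSpace /\
  faithful StateSpace /\
  (forall G : Obj DiGraph,
     in_essential_image StateSpace G <-> unique_out_edge G).
Proof.
  split; [exact state_space_full |].
  split; [exact state_space_faithful |].
  intros G; split.
  - intros [A iso].
    exact (unique_out_edge_isomorphic _ _ iso (unique_out_edge_state_space A)).
  - apply unique_out_edge_in_essential_image.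
Qed.
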